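(* Let $S=\mathbb{C}^{\oplus n}$ with orthogonal idempotents $e_1,\dots,e_n$, $T=\mathbb{C}^{\oplus m}$ with orthogonal idempotents $f_1,\dots,f_m$, and let $P=\sum_{i\ne j}c_{ij}a_{ij}a_{ji}$ and $P'=\sum_{k\neq l}d_{kl}b_{kl}b_{lk}$ be double Poisson tensors for $S$ and $T$. Put $\overline c_{ij}=c_{ij}-c_{ji}$, $\overline d_{kl}=d_{kl}-d_{lk}$, $\overline e_i=-\sum_{s\ne i}\overline c_{is}e_s$, $\overline f_k=-\sum_{s\neq k}\overline d_{ks}f_s$. Let $x=e_{i_1}*f_{i_1'}*\dots*e_{i_p}*f_{i_p'}$ and $y=e_{j_1}*f_{j_1'}*\dots*e_{j_q}*f_{j_q'}$ be words in $S*T$. Then the Poisson bracket induced by $P$ and $P'$ on the quotient variety of isomorphism classes of semi-simple $N$-dimensional representations of $S*T$ (for any $N$) satisfies $$\begin{aligned}\{\mathrm{tr}(x),\mathrm{tr}(y)\}=\sum_{\ell=1}^p\Big[&\mathrm{tr}\Big(\sigma^{2\ell-1}(x)*\Big(\sum_{k:\,j_k'\ne i_\ell'}\overline d_{i_\ell'j_k'}\,\sigma^{2k-1}(y)-\sum_{k:\,j_k\neq i_\ell}\overline c_{i_\ell j_k}\,\sigma^{2k-1}(y)\Big)\Big)\\&-\mathrm{tr}\Big(\sigma^{2\ell}(x)*\Big(\sum_{k:\,j_k'\ne i_\ell'}\overline d_{i_\ell'j_k'}\,\sigma^{2k}(y)-\sum_{k:\,j_{k+1}\neq i_{\ell+1}}\overline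 c_{i_{\ell+1}j_{k+1}}\,\sigma^{2k}(y)\Big)\Big)\\&+\sum_{k:\,j_k'=i_\ell'}\Big(\mathrm{tr}(\sigma^{2\ell-1}(x)*\sigma^{2k-1}(y_k))-\mathrm{tr}(\sigma^{2\ell}(x)*\sigma^{2k}(y_k))\Big)\\&+\sum_{k:\,j_k=i_\ell}\Big(\mathrm{tr}(\sigma^{2(\ell-1)}(x)*\sigma^{2(k-1)}({}_ky))-\mathrm{tr}(\sigma^{2\ell-1}(x)*\sigma^{2k-1}({}_ky))\Big)\Big],\end{aligned}$$ where all sums over $k$ are over $1\le k\le q$ with the indicated restriction, $i_{p+1}:=i_1$, $j_{q+1}:=j_1$, $\sigma$ is the cyclic permutation of words $\sigma(a*w)=w*a$ ($a$ the first letter), $y_k$ is the word $y$ with its letter $f_{j_k'}$ replaced by $\overline f_{j_k'}$, and ${}_ky$ is the word $y$ with its letter $e_{j_k}$ replaced by $\overline e_{j_k}$.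
   Context: $\mathbb{C}$ is an algebraically closed field of characteristic $0$, $\otimes=\otimes_{\mathbb{C}}$. $S*T$ is the free product of algebras, with product written $*$. For $i\neq j$, $a_{ij}$ is the double derivation $s\mapsto e_i\otimes e_js-se_i\otimes e_j$ of $S$ (corresponding to the arrow from $j$ to $i$ in the double derivation quiver of $S$), and $b_{kl}$ is the analogous double derivation of $T$ built from $f_k,f_l$. $P$ (resp. $P'$) is an element of degree $2$ of the tensor algebra $T_S\mathrm{Der}(S,S\otimes S)$ (resp. for $T$) and defines a double bracket on $S$ (resp. $T$); with the sign convention used for this result these are determined by $\{\!\!\{e_a,e_b\}\!\!\}=(c_{ab}-c_{ba})(e_a\otimes e_b-e_b\otimes e_a)$ for $a\ne b$, $\{\!\!\{e_a,e_a\}\!\!\}=-\sum_{s\ne a}\{\!\!\{e_a,e_s\}\!\!\}$, and likewise $\{\!\!\{f_a,f_b\}\!\!\}=(d_{ab}-d_{ba})(f_a\otimes f_b-f_b\otimes f_a)$ for $a\neq b$, $\{\!\!\{f_a,f_a\}\!\!\}=-\sum_{s\neq a}\{\!\!\{f_a,f_s\}\!\!\}$. ''Double Poisson tensor'' means that the resulting double bracket is a double Poisson bracket. A double Poisson bracket on an algebra $A$ is a linear map $A\otimes A\to A\otimes A$ that is a derivation in the second argument for the outer bimodule structure $a\cdot(a'\otimes a'')\cdot b=aa'\otimes a''b$, satisfies $\{\!\!\{a,b\}\!\!\}=-\{\!\!\{b,a\}\!\!\}^o$ with $(x\otimes y)^o=y\otimes x$ (hence is a derivation in the first argument for the inner structure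 $a\circ(a'\otimes a'')\circ b=a'b\otimes aa''$), and satisfies the double Jacobi identity $\{\!\!\{a,\{\!\!\{b,c\}\!\!\}\}\!\!\}_L+\tau\{\!\!\{b,\{\!\!\{c,a\}\!\!\}\}\!\!\}_L+\tau^2\{\!\!\{c,\{\!\!\{a,b\}\!\!\}\}\!\!\}_L=0$, where $\{\!\!\{a,x\otimes y\}\!\!\}_L=\{\!\!\{a,x\}\!\!\}\otimes y$ and $\tau(x\otimes y\otimes z)=z\otimes x\otimes y$. $P$ and $P'$ induce on $S*T$ the unique double Poisson bracket extending the two given ones with $\{\!\!\{s,t\}\!\!\}=0$ for $s\in S$, $t\in T$. A double Poisson bracket on $A$ induces a Poisson bracket on the coordinate ring of the variety of $N$-dimensional representations by $\{a_{ij},b_{kl}\}=\{\!\!\{a,b\}\!\!\}'_{kj}\{\!\!\{a,b\}\!\!\}''_{il}$ (Sweedler notation, $a_{ij}$ the $(i,j)$ matrix coordinate function of $a$), which restricts to the ring of $\mathrm{GL}_N$-invariants, the coordinate ring of the quotient variety of isomorphism classes of semi-simple $N$-dimensional representations; $\mathrm{tr}(a)=\sum_ia_{ii}$ is the invariant function given by the trace of $a$. *)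

(* Defs.v *)
From HB Require Import structures.
From mathcomp Require Import all_boot all_order all_algebra.
From mathcomp Require Import boolp functions.

Set Implicit Arguments.
Unset Strict Implicit.
Unset Printing Implicit Defensive.

Import GRing.Theory.
Local Open Scope quotient_scope.
Local Open Scope ring_scope.

Notation bilinear f := (bilinear_for *:%R *:%R f).

(* The tensor product of two modules: formal sums of pairs (v, w), two of them
   being identified when every bilinear map takes the same value on both. *)
Section Tensor.
Variables (R : comNzRingType) (V W : lmodType R).
Implicit Types (U : lmodType R) (s : seq (V * W)).

Definition fsum U (f : V -> W -> U) s : U := \sum_(p <- s) f p.1 p.2.

Definition tensor_eq s s' : bool :=
  `[< forall U (f : V -> W -> U), bilinear f -> fsum f s = fsum f s' >].

Lemma tensor_eq_class : equiv_class_of tensor_eq.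
Proof.
split=> [s|s s'|s2 s1 s3]; rewrite /tensor_eq.
- by apply/asboolP.
- by apply/asboolP/asboolP => h U f bf; rewrite h.
- by move=> /asboolP h1 /asboolP h2; apply/asboolP => U f bf; rewrite h1 ?h2.
Qed.

Canonical tensor_equiv := EquivRelPack tensor_eq_class.

Definition tensor : Type := {eq_quot tensor_equiv}.
HB.instance Definition _ := EqQuotient.on tensor.
HB.instance Definition _ := Choice.on tensor.

Definition tens (v : V) (w : W) : tensor := \pi_tensor [:: (v, w)].

(* The map induced by f; only meaningful when f is bilinear. *)
Definition tlift U (f : V -> W -> U) (t : tensor) : U := fsum f (repr t).

Lemma tlift_pi U (f : V -> W -> U) s : bilinear f ->
  tlift f (\pi_tensor s) = fsum f s.
Proof.
move=> bf; have /eqmodP/asboolP h := reprK (\pi_tensor s); exact: h.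
Qed.

Lemma tensor_ext (t t' : tensor) :
  (forall U (f : V -> W -> U), bilinear f -> tlift f t = tlift f t') -> t = t'.
Proof.
move=> h; rewrite -[t]reprK -[t']reprK; apply/eqmodP/asboolP => U f bf.
exact: h.
Qed.

Lemma bilinear0l U (f : V -> W -> U) w : bilinear f -> f 0 w = 0.
Proof.
case=> h _; have := h w (-1) 0 0 => /=.
by rewrite scaler0 addr0 scaleN1r addNr.
Qed.

Lemma bilinearDl U (f : V -> W -> U) v v' w : bilinear f ->
  f (v + v') w = f v w + f v' w.
Proof. by case=> h _; have := h w 1 v v'; rewrite /= !scale1r. Qed.

Lemma bilinearZl U (f : V -> W -> U) a v w : bilinear f ->
  f (a *: v) w = a *: f v w.
Proof.
move=> bf; case: (bf) => h _.
by have := h w a v 0; rewrite /= addr0 (bilinear0l w bf) addr0.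
Qed.

Lemma bilinearDr U (f : V -> W -> U) v w w' : bilinear f ->
  f v (w + w') = f v w + f v w'.
Proof. by case=> _ h; have := h v 1 w w'; rewrite /= !scale1r. Qed.

Lemma bilinear0r U (f : V -> W -> U) v : bilinear f -> f v 0 = 0.
Proof.
case=> _ h; have := h v (-1) 0 0 => /=.
by rewrite scaler0 addr0 scaleN1r addNr.
Qed.

Lemma bilinearZr U (f : V -> W -> U) a v w : bilinear f ->
  f v (a *: w) = a *: f v w.
Proof.
move=> bf; case: (bf) => _ h.
by have := h v a w 0; rewrite /= addr0 (bilinear0r v bf) addr0.
Qed.

Definition scale_fsum (a : R) s := [seq (a *: p.1, p.2) | p <- s].

Lemma fsum_scale U (f : V -> W -> U) a s : bilinear f ->
  fsum f (scale_fsum a s) = a *: fsum f s.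
Proof.
move=> bf; rewrite /fsum big_map scaler_sumr.
by apply: eq_bigr => p _ /=; rewrite bilinearZl.
Qed.

Lemma fsum_cat U (f : V -> W -> U) s s' :
  fsum f (s ++ s') = fsum f s + fsum f s'.
Proof. by rewrite /fsum big_cat. Qed.

Definition tensor_zero : tensor := \pi_tensor [::].
Definition tensor_add (t t' : tensor) : tensor := \pi_tensor (repr t ++ repr t').
Definition tensor_scale (a : R) (t : tensor) : tensor :=
  \pi_tensor (scale_fsum a (repr t)).
Definition tensor_opp (t : tensor) : tensor := tensor_scale (-1) t.

Lemma tlift0 U (f : V -> W -> U) : bilinear f -> tlift f tensor_zero = 0.
Proof. by move=> bf; rewrite tlift_pi // /fsum big_nil. Qed.

Lemma tliftD U (f : V -> W -> U) t t' : bilinear f ->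
  tlift f (tensor_add t t') = tlift f t + tlift f t'.
Proof. by move=> bf; rewrite tlift_pi // fsum_cat. Qed.

Lemma tliftZ U (f : V -> W -> U) a t : bilinear f ->
  tlift f (tensor_scale a t) = a *: tlift f t.
Proof. by move=> bf; rewrite tlift_pi // fsum_scale. Qed.

Let tE := (tlift0, tliftD, tliftZ).

Fact tensor_addA : associative tensor_add.
Proof. by move=> x y z; apply: tensor_ext => U f bf; rewrite !tE // addrA. Qed.
Fact tensor_addC : commutative tensor_add.
Proof. by move=> x y; apply: tensor_ext => U f bf; rewrite !tE // addrC. Qed.
Fact tensor_add0 : left_id tensor_zero tensor_add.
Proof. by move=> x; apply: tensor_ext => U f bf; rewrite !tE // add0r. Qed.
Fact tensor_addN : left_inverse tensor_zero tensor_opp tensor_add.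
Proof.
by move=> x; apply: tensor_ext => U f bf; rewrite !tE // scaleN1r addNr.
Qed.
HB.instance Definition _ := GRing.isZmodule.Build tensor
  tensor_addA tensor_addC tensor_add0 tensor_addN.

Fact tensor_scaleA a b t :
  tensor_scale a (tensor_scale b t) = tensor_scale (a * b) t.
Proof. by apply: tensor_ext => U f bf; rewrite !tE // scalerA. Qed.
Fact tensor_scale1 : left_id 1 tensor_scale.
Proof. by move=> t; apply: tensor_ext => U f bf; rewrite !tE // scale1r. Qed.
Fact tensor_scaleDr : right_distributive tensor_scale +%R.
Proof. by move=> a x y; apply: tensor_ext => U f bf; rewrite !tE // scalerDr. Qed.
Fact tensor_scaleDl t : {morph tensor_scale^~ t : a b / a + b}.
Proof. by move=> a b; apply: tensor_ext => U f bf; rewrite !tE // scalerDl. Qed.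
HB.instance Definition _ := GRing.Zmodule_isLmodule.Build R tensor
  tensor_scaleA tensor_scale1 tensor_scaleDr tensor_scaleDl.

Lemma tlift_linear U (f : V -> W -> U) : bilinear f -> linear (tlift f).
Proof. by move=> bf a x y; rewrite tliftD // tliftZ. Qed.

Lemma tlift_tens U (f : V -> W -> U) v w : bilinear f ->
  tlift f (tens v w) = f v w.
Proof. by move=> bf; rewrite tlift_pi // /fsum big_seq1. Qed.

Lemma tens_bilinear : bilinear tens.
Proof.
split=> [w a v v'|v a w w'] /=; apply: tensor_ext => U f bf;
  rewrite (tlift_linear bf) !tlift_tens //.
- by rewrite bilinearDl // bilinearZl.
- by rewrite bilinearDr // bilinearZr.
Qed.

Lemma tensorE (t : tensor) : t = \sum_(p <- repr t) tens p.1 p.2.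
Proof.
apply: tensor_ext => U f bf.
pose g : {linear tensor -> U} := HB.pack (tlift f)
  (GRing.isLinear.Build R tensor U *:%R (tlift f) (tlift_linear bf)).
rewrite -[RHS]/(g _) linear_sum [LHS]/tlift /fsum.
by apply: eq_bigr => p _; rewrite /= tlift_tens.
Qed.

Lemma tlift_unique U (g h : {linear tensor -> U}) :
  (forall v w, g (tens v w) = h (tens v w)) -> g =1 h.
Proof.
move=> gh t; rewrite (tensorE t) !linear_sum /=.
by apply: eq_bigr => p _; rewrite gh.
Qed.

End Tensor.

Lemma tlift_param (R : comNzRingType) (V W V' W' U : lmodType R)
    (F : V -> W -> V' -> W' -> U) (u : tensor V' W') :
  (forall v' w', bilinear (fun v w => F v w v' w')) ->
  bilinear (fun v w => tlift (F v w) u).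
Proof.
move=> bF; split=> [w a v v'|v a w w'] /=; rewrite /tlift /fsum;
  rewrite scaler_sumr -big_split; apply: eq_bigr => p _ /=.
- by rewrite (bilinearDl _ _ _ (bF p.1 p.2)) (bilinearZl _ _ _ (bF p.1 p.2)).
- by rewrite (bilinearDr _ _ _ (bF p.1 p.2)) (bilinearZr _ _ _ (bF p.1 p.2)).
Qed.

Arguments tens {R V W}.
Notation "V '\otimes' W" := (tensor V%type W%type)
  (at level 40, left associativity) : type_scope.
Notation "v '\ot' w" := (tens v w)
  (at level 40, left associativity) : ring_scope.

(* The free product (coproduct of unital algebras): formal linear combinations
   of words with letters in S and in T, two of them being identified when they
   take the same value under every pair of algebra morphisms from S and T to a
   common algebra. *)
Section FreeProduct.
Variables (R : comNzRingType) (S T : algType R).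
Implicit Types (B : algType R) (x y z : seq (R * seq (S + T))).

Section Eval.
Variables (B : algType R) (g : {lrmorphism S -> B}) (h : {lrmorphism T -> B}).

Definition eval_letter (l : S + T) : B :=
  match l with inl s => g s | inr t => h t end.
Definition eval_word (w : seq (S + T)) : B := \prod_(l <- w) eval_letter l.
Definition eval_sum x : B := \sum_(p <- x) p.1 *: eval_word p.2.

End Eval.

Definition freeprod_eq x y : bool :=
  `[< forall B (g : {lrmorphism S -> B}) (h : {lrmorphism T -> B}),
        eval_sum g h x = eval_sum g h y >].

Lemma freeprod_eq_class : equiv_class_of freeprod_eq.
Proof.
split=> [x|x y|y x z]; rewrite /freeprod_eq.
- by apply/asboolP.
- by apply/asboolP/asboolP => E B g h; rewrite E.
- by move=> /asboolP E1 /asboolP E2; apply/asboolP => B g h; rewrite E1 E2.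
Qed.

Canonical freeprod_equiv := EquivRelPack freeprod_eq_class.

Definition freeprod : Type := {eq_quot freeprod_equiv}.
HB.instance Definition _ := EqQuotient.on freeprod.
HB.instance Definition _ := Choice.on freeprod.

Definition in_left (s : S) : freeprod := \pi_freeprod [:: (1, [:: inl s])].
Definition in_right (t : T) : freeprod := \pi_freeprod [:: (1, [:: inr t])].

Definition freeprod_lift B (g : {lrmorphism S -> B}) (h : {lrmorphism T -> B})
  (u : freeprod) : B := eval_sum g h (repr u).

Lemma freeprod_lift_pi B (g : {lrmorphism S -> B}) (h : {lrmorphism T -> B}) x :
  freeprod_lift g h (\pi_freeprod x) = eval_sum g h x.
Proof.
have /eqmodP/asboolP E := reprK (\pi_freeprod x); exact: E.
Qed.

Lemma freeprod_ext (u v : freeprod) :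
  (forall B (g : {lrmorphism S -> B}) (h : {lrmorphism T -> B}),
     freeprod_lift g h u = freeprod_lift g h v) -> u = v.
Proof.
move=> E; rewrite -[u]reprK -[v]reprK; apply/eqmodP/asboolP => B g h.
exact: E.
Qed.

Definition freeprod_zero : freeprod := \pi_freeprod [::].
Definition freeprod_one : freeprod := \pi_freeprod [:: (1, [::])].
Definition freeprod_add (u v : freeprod) : freeprod := \pi_freeprod (repr u ++ repr v).
Definition freeprod_scale (a : R) (u : freeprod) : freeprod :=
  \pi_freeprod [seq (a * p.1, p.2) | p <- repr u].
Definition freeprod_opp (u : freeprod) : freeprod := freeprod_scale (-1) u.
Definition freeprod_mul (u v : freeprod) : freeprod :=
  \pi_freeprod [seq (p.1 * r.1, p.2 ++ r.2) | p <- repr u, r <- repr v].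

Section Lift.
Variables (B : algType R) (g : {lrmorphism S -> B}) (h : {lrmorphism T -> B}).
Local Notation lift := (freeprod_lift g h).

Lemma lift0 : lift freeprod_zero = 0.
Proof. by rewrite freeprod_lift_pi /eval_sum big_nil. Qed.

Lemma lift1 : lift freeprod_one = 1.
Proof.
by rewrite freeprod_lift_pi /eval_sum big_seq1 /= scale1r /eval_word big_nil.
Qed.

Lemma liftD u v : lift (freeprod_add u v) = lift u + lift v.
Proof. by rewrite freeprod_lift_pi /eval_sum big_cat. Qed.

Lemma liftZ a u : lift (freeprod_scale a u) = a *: lift u.
Proof.
rewrite freeprod_lift_pi /eval_sum big_map scaler_sumr.
by apply: eq_bigr => p _ /=; rewrite scalerA.
Qed.

Lemma liftM u v : lift (freeprod_mul u v) = lift u * lift v.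
Proof.
rewrite freeprod_lift_pi /eval_sum big_allpairs_dep mulr_suml.
apply: eq_bigr => p _; rewrite mulr_sumr; apply: eq_bigr => r _ /=.
by rewrite /eval_word big_cat /= -scalerAl -scalerAr scalerA.
Qed.

Lemma lift_left s : lift (in_left s) = g s.
Proof.
by rewrite freeprod_lift_pi /eval_sum big_seq1 /= scale1r /eval_word big_seq1.
Qed.

Lemma lift_right t : lift (in_right t) = h t.
Proof.
by rewrite freeprod_lift_pi /eval_sum big_seq1 /= scale1r /eval_word big_seq1.
Qed.

End Lift.

Let lE := (lift0, lift1, liftD, liftZ, liftM, lift_left, lift_right).

Fact freeprod_addA : associative freeprod_add.
Proof. by move=> x y z; apply: freeprod_ext => B g h; rewrite !lE addrA. Qed.
Fact freeprod_addC : commutative freeprod_add.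
Proof. by move=> x y; apply: freeprod_ext => B g h; rewrite !lE addrC. Qed.
Fact freeprod_add0 : left_id freeprod_zero freeprod_add.
Proof. by move=> x; apply: freeprod_ext => B g h; rewrite !lE add0r. Qed.
Fact freeprod_addN : left_inverse freeprod_zero freeprod_opp freeprod_add.
Proof.
by move=> x; apply: freeprod_ext => B g h; rewrite !lE scaleN1r addNr.
Qed.
HB.instance Definition _ := GRing.isZmodule.Build freeprod
  freeprod_addA freeprod_addC freeprod_add0 freeprod_addN.

Fact freeprod_scaleA a b u :
  freeprod_scale a (freeprod_scale b u) = freeprod_scale (a * b) u.
Proof. by apply: freeprod_ext => B g h; rewrite !lE scalerA. Qed.
Fact freeprod_scale1 : left_id 1 freeprod_scale.
Proof. by move=> u; apply: freeprod_ext => B g h; rewrite !lE scale1r. Qed.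
Fact freeprod_scaleDr : right_distributive freeprod_scale +%R.
Proof. by move=> a x y; apply: freeprod_ext => B g h; rewrite !lE scalerDr. Qed.
Fact freeprod_scaleDl u : {morph freeprod_scale^~ u : a b / a + b}.
Proof. by move=> a b; apply: freeprod_ext => B g h; rewrite !lE scalerDl. Qed.
HB.instance Definition _ := GRing.Zmodule_isLmodule.Build R freeprod
  freeprod_scaleA freeprod_scale1 freeprod_scaleDr freeprod_scaleDl.

Fact freeprod_mulA : associative freeprod_mul.
Proof. by move=> x y z; apply: freeprod_ext => B g h; rewrite !lE mulrA. Qed.
Fact freeprod_mul1l : left_id freeprod_one freeprod_mul.
Proof. by move=> x; apply: freeprod_ext => B g h; rewrite !lE mul1r. Qed.
Fact freeprod_mul1r : right_id freeprod_one freeprod_mul.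
Proof. by move=> x; apply: freeprod_ext => B g h; rewrite !lE mulr1. Qed.
Fact freeprod_mulDl : left_distributive freeprod_mul +%R.
Proof. by move=> x y z; apply: freeprod_ext => B g h; rewrite !lE mulrDl. Qed.
Fact freeprod_mulDr : right_distributive freeprod_mul +%R.
Proof. by move=> x y z; apply: freeprod_ext => B g h; rewrite !lE mulrDr. Qed.
HB.instance Definition _ := GRing.Zmodule_isPzRing.Build freeprod
  freeprod_mulA freeprod_mul1l freeprod_mul1r freeprod_mulDl freeprod_mulDr.

Lemma freeprod_scaleAl a (u v : freeprod) : a *: (u * v) = (a *: u) * v.
Proof. by apply: freeprod_ext => B g h; rewrite !lE scalerAl. Qed.
Lemma freeprod_scaleAr a (u v : freeprod) : a *: (u * v) = u * (a *: v).
Proof. by apply: freeprod_ext => B g h; rewrite !lE scalerAr. Qed.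

Fact in_left_linear : linear in_left.
Proof. by move=> a s s'; apply: freeprod_ext => B g h; rewrite !lE linearP. Qed.
HB.instance Definition _ := GRing.isLinear.Build R S freeprod *:%R in_left
  in_left_linear.
Fact in_left_monoid : monoid_morphism in_left.
Proof.
by split=> [|s s']; apply: freeprod_ext => B g h; rewrite !lE ?rmorph1 ?rmorphM.
Qed.
HB.instance Definition _ := GRing.isMonoidMorphism.Build S freeprod in_left
  in_left_monoid.

Fact in_right_linear : linear in_right.
Proof. by move=> a s s'; apply: freeprod_ext => B g h; rewrite !lE linearP. Qed.
HB.instance Definition _ := GRing.isLinear.Build R T freeprod *:%R in_right
  in_right_linear.
Fact in_right_monoid : monoid_morphism in_right.
Proof.
by split=> [|s s']; apply: freeprod_ext => B g h; rewrite !lE ?rmorph1 ?rmorphM.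
Qed.
HB.instance Definition _ := GRing.isMonoidMorphism.Build T freeprod in_right
  in_right_monoid.

Section LiftMorphism.
Variables (B : algType R) (g : {lrmorphism S -> B}) (h : {lrmorphism T -> B}).

Fact freeprod_lift_linear : linear (freeprod_lift g h).
Proof. by move=> a u v; rewrite !lE. Qed.
HB.instance Definition _ := GRing.isLinear.Build R freeprod B *:%R
  (freeprod_lift g h) freeprod_lift_linear.
Fact freeprod_lift_monoid : monoid_morphism (freeprod_lift g h).
Proof. by split=> [|u v]; rewrite !lE. Qed.
HB.instance Definition _ := GRing.isMonoidMorphism.Build freeprod B
  (freeprod_lift g h) freeprod_lift_monoid.

End LiftMorphism.

Definition letter (l : S + T) : freeprod :=
  match l with inl s => in_left s | inr t => in_right t end.

Lemma freeprodE (u : freeprod) :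
  u = \sum_(p <- repr u) p.1 *: \prod_(l <- p.2) letter l.
Proof.
apply: freeprod_ext => B g h; rewrite linear_sum.
apply: eq_bigr => p _; rewrite linearZ rmorph_prod; congr (_ *: _).
by apply: eq_bigr => -[s|t] _; rewrite /= !lE.
Qed.

Lemma freeprod_lift_unique B (k : {rmorphism freeprod -> B})
    (g : {lrmorphism S -> B}) (h : {lrmorphism T -> B}) :
  scalable k -> (forall s, k (in_left s) = g s) ->
  (forall t, k (in_right t) = h t) -> k =1 freeprod_lift g h.
Proof.
move=> kZ kl kr u; rewrite (freeprodE u) !linear_sum rmorph_sum /=.
apply: eq_bigr => p _; rewrite linearZ kZ !rmorph_prod; congr (_ *: _).
by apply: eq_bigr => -[s|t] _; rewrite /= ?kl ?kr !lE.
Qed.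

End FreeProduct.

Section DoubleBracket.
Variables (R : comNzRingType) (A : algType R).

(* In Sweedler notation: outer a t b = a t' \ot t'' b and
   nested t u = t' u'' \ot u' t''. *)
Definition outer (a : A) (t : A \otimes A) (b : A) : A \otimes A :=
  tlift (fun t1 t2 => (a * t1) \ot (t2 * b)) t.
Definition nested (t u : A \otimes A) : A \otimes A :=
  tlift (fun t1 t2 => tlift (fun u1 u2 => (t1 * u2) \ot (u1 * t2)) u) t.

Definition tswap (t : A \otimes A) : A \otimes A :=
  tlift (fun t1 t2 => t2 \ot t1) t.

Definition tau (t : A \otimes A \otimes A) : A \otimes A \otimes A :=
  tlift (fun xy z => tlift (fun x y => z \ot x \ot y) xy) t.

(* Linear maps out of A \otimes A are given as bilinear maps on A. *)
Implicit Type br : A -> A -> A \otimes A.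

Definition bracketL br (a : A) (t : A \otimes A) : A \otimes A \otimes A :=
  tlift (fun x y => br a x \ot y) t.

Record double_bracket br : Prop := DoubleBracket {
  double_bracket_bilinear : bilinear br;
  double_bracket_derivation : forall a b c,
    br a (b * c) = outer 1 (br a b) c + outer b (br a c) 1;
  double_bracket_skew : forall a b, br a b = - tswap (br b a) }.

Record double_poisson_bracket br : Prop := DoublePoissonBracket {
  double_poisson_double :> double_bracket br;
  double_jacobi : forall a b c,
    bracketL br a (br b c) + tau (bracketL br b (br c a))
      + tau (tau (bracketL br c (br a b))) = 0 }.

(* The double bracket of the degree-two element D E of the tensor algebra of
   double derivations, with the sign for which [quad_bracket_neq] below holds
   (the opposite of Van den Bergh's):
   {{a, b}} = D(b)' E(a)'' \ot E(a)' D(b)'' - E(b)' D(a)'' \ot D(a)' E(b)''. *)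
Definition dder_bracket (D E : A -> A \otimes A) (a b : A) : A \otimes A :=
  nested (D b) (E a) - nested (E b) (D a).

Lemma nested_bilinear_left (u1 u2 : A) :
  bilinear (fun t1 t2 => (t1 * u2) \ot (u1 * t2)).
Proof.
have bt := tens_bilinear A A.
split=> [w a v v'|v a w w'] /=.
- by rewrite mulrDl -scalerAl (bilinearDl _ _ _ bt) (bilinearZl _ _ _ bt).
- by rewrite mulrDr -scalerAr (bilinearDr _ _ _ bt) (bilinearZr _ _ _ bt).
Qed.

Lemma nested_bilinear_right (t1 t2 : A) :
  bilinear (fun u1 u2 => (t1 * u2) \ot (u1 * t2)).
Proof.
have bt := tens_bilinear A A.
split=> [w a v v'|v a w w'] /=.
- by rewrite mulrDl -scalerAl (bilinearDr _ _ _ bt) (bilinearZr _ _ _ bt).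
- by rewrite mulrDr -scalerAr (bilinearDl _ _ _ bt) (bilinearZl _ _ _ bt).
Qed.

Lemma nested_bilinear : bilinear nested.
Proof.
split=> [u a t t'|t a u u'].
- exact/tlift_linear/tlift_param/nested_bilinear_left.
- have E v : nested t v = \sum_(p <- repr t)
      tlift (fun u1 u2 => (p.1 * u2) \ot (u1 * p.2)) v by [].
  rewrite /= !E scaler_sumr -big_split; apply: eq_bigr => p _.
  exact/tlift_linear/nested_bilinear_right.
Qed.

Lemma nested_tens x y z w : nested (x \ot y) (z \ot w) = (x * w) \ot (z * y).
Proof.
rewrite /nested tlift_tens; first by rewrite tlift_tens //; exact: nested_bilinear_right.
by apply: tlift_param; exact: nested_bilinear_left.
Qed.

Lemma nestedZ a b t u : nested (a *: t) (b *: u) = (a * b) *: nested t u.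
Proof.
by rewrite (bilinearZl _ _ _ nested_bilinear) (bilinearZr _ _ _ nested_bilinear)
  scalerA.
Qed.

End DoubleBracket.

(* R^(n+1): the index is shifted because an algebra must be non-trivial. *)
Section Split.
Variables (R : comNzRingType) (n : nat).

Definition split_alg : Type := {ffun 'I_n.+1 -> R^o}.
HB.instance Definition _ := GRing.Lmodule.on split_alg.
HB.instance Definition _ := GRing.PzRing.on split_alg.

Fact split_oner_neq0 : 1 != 0 :> split_alg.
Proof. by apply/eqP => /ffunP/(_ ord0)/eqP; rewrite !ffunE oner_eq0. Qed.
HB.instance Definition _ :=
  GRing.PzSemiRing_isNonZero.Build split_alg split_oner_neq0.

Fact split_mulC : commutative (@GRing.mul split_alg).
Proof. by move=> x y; apply/ffunP => i; rewrite !ffunE mulrC. Qed.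
HB.instance Definition _ :=
  GRing.PzRing_hasCommutativeMul.Build split_alg split_mulC.

Fact split_scaleAl (a : R) (x y : split_alg) : a *: (x * y) = a *: x * y.
Proof. by apply/ffunP => i; rewrite !ffunE; apply: mulrA. Qed.
HB.instance Definition _ :=
  GRing.LSemiModule_isLSemiAlgebra.Build R split_alg split_scaleAl.
HB.instance Definition _ := GRing.Lalgebra_isComAlgebra.Build R split_alg.

Definition idem (i : 'I_n.+1) : split_alg := [ffun j => (j == i)%:R].

(* The double derivation of [split_alg] given by the arrow from j to i. *)
Definition arrow (i j : 'I_n.+1) (s : split_alg) : split_alg \otimes split_alg :=
  idem i \ot (idem j * s) - (s * idem i) \ot idem j.

Variable c : 'I_n.+1 -> 'I_n.+1 -> R.

(* The double bracket of \sum_(i != j) c_ij a_ij a_ji. *)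
Definition quad_bracket (a b : split_alg) : split_alg \otimes split_alg :=
  \sum_i \sum_(j | j != i) c i j *: dder_bracket (arrow i j) (arrow j i) a b.

Definition skew_coef (i j : 'I_n.+1) : R := c i j - c j i.

Definition idem_bar (i : 'I_n.+1) : split_alg :=
  - \sum_(s | s != i) skew_coef i s *: idem s.

Lemma idemM i j : idem i * idem j = (i == j)%:R *: idem i.
Proof.
apply/ffunP => k; rewrite !ffunE.
have [->|nij] := eqVneq i j; rewrite ?scale1r ?scale0r.
  by case: (k == j); rewrite ?mulr1 ?mulr0.
by have [->|] := eqVneq k i; rewrite ?mul0r // mul1r (negbTE nij).
Qed.

Lemma arrow_idem i j a :
  arrow i j (idem a) = ((a == j)%:R - (a == i)%:R) *: (idem i \ot idem j).
Proof.
rewrite /arrow !idemM (bilinearZr _ _ _ (tens_bilinear split_alg split_alg)).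
rewrite (bilinearZl _ _ _ (tens_bilinear split_alg split_alg)) scalerBl eq_sym.
by have [->|] := eqVneq a i; rewrite ?scale0r.
Qed.

Lemma quad_bracket_idem a b : quad_bracket (idem a) (idem b) =
  \sum_i \sum_(j | j != i)
    (c i j * (((a == j)%:R - (a == i)%:R) * ((b == j)%:R - (b == i)%:R))) *:
    (idem j \ot idem i - idem i \ot idem j).
Proof.
apply: eq_bigr => i _; apply: eq_bigr => j _; rewrite -scalerA; congr (_ *: _).
rewrite /dder_bracket !arrow_idem !nestedZ !nested_tens !idemM !eqxx !scale1r.
rewrite scalerBr -(opprB (a == j)%:R) -(opprB (b == j)%:R).
by rewrite mulrN mulNr !scaleNr opprK addrC; congr (_ *: _ - _ *: _);
   rewrite mulrC.
Qed.

Let tens_commE (r : R) i j :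
  r *: (idem j \ot idem i - idem i \ot idem j) =
  - (r *: (idem i \ot idem j - idem j \ot idem i)).
Proof. by rewrite -scalerN opprB. Qed.

Lemma quad_bracket_neq a b : a != b ->
  quad_bracket (idem a) (idem b) =
    skew_coef a b *: (idem a \ot idem b - idem b \ot idem a).
Proof.
move=> nab; have nba : b != a by rewrite eq_sym.
rewrite quad_bracket_idem (bigD1 a) //= (bigD1 b) //=.
rewrite [X in _ + X + _]big1 => [|j /andP[ja jb]]; last first.
  by rewrite [b == j]eq_sym (negbTE nba) (negbTE jb) subrr !mulr0 scale0r.
rewrite addr0 (bigD1 b) //= [X in _ + (X + _)](bigD1 a) //=.
rewrite [X in _ + (_ + X + _)]big1 => [|j /andP[jb ja]]; last first.
  by rewrite [a == j]eq_sym (negbTE nab) (negbTE ja) subrr mul0r mulr0 scale0r.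
rewrite addr0 [X in _ + (_ + X)]big1 => [|i /andP[ia ib]]; last first.
  apply: big1 => j ji; rewrite (eq_sym a i) (eq_sym b i) (negbTE ia) (negbTE ib).
  rewrite !subr0; have [<-|_] := eqVneq a j; last by rewrite mul0r mulr0 scale0r.
  by rewrite (negbTE nba) !mulr0 scale0r.
rewrite !eqxx (negbTE nab) (negbTE nba) !subr0 !sub0r mulr1 mul1r !mulrN1 addr0.
by rewrite tens_commE scaleNr opprK scaleNr -scaleNr -scalerDl.
Qed.

Lemma quad_bracket_diag a : quad_bracket (idem a) (idem a) =
  - \sum_(s | s != a) quad_bracket (idem a) (idem s).
Proof.
rewrite quad_bracket_idem (bigD1 a) //= -sumrN.
under [in RHS]eq_bigr => s sa.
  rewrite quad_bracket_neq 1?eq_sym // /skew_coef scalerBl opprB addrC; over.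
rewrite big_split; congr (_ + _); apply: eq_bigr => i ia /=.
  rewrite eqxx (eq_sym a i) (negbTE ia) sub0r mulrNN !mulr1.
  exact: tens_commE.
have ai : a != i by rewrite eq_sym.
rewrite (bigD1 a) //= eqxx (negbTE ai) subr0 !mulr1.
rewrite big1 ?addr0 // => j /andP[ji ja].
by rewrite (eq_sym a j) (negbTE ja) subrr !mulr0 scale0r.
Qed.

End Split.
Arguments idem {R n}.

Section SplitFreeProduct.
Variables (R : comNzRingType) (n m : nat).

Definition split_eval (k : nat) (x : split_alg R k) : R^o := x ord0.
Fact split_eval_linear k : linear (@split_eval k).
Proof. by move=> a x y; rewrite /split_eval !ffunE. Qed.
HB.instance Definition _ k := GRing.isLinear.Build R (split_alg R k) R^o *:%R
  (@split_eval k) (@split_eval_linear k).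
Fact split_eval_monoid k : monoid_morphism (@split_eval k).
Proof. by split=> [|x y]; rewrite /split_eval !ffunE. Qed.
HB.instance Definition _ k := GRing.isMonoidMorphism.Build (split_alg R k) R^o
  (@split_eval k) (@split_eval_monoid k).

Definition split_freeprod : Type := freeprod (split_alg R n) (split_alg R m).
HB.instance Definition _ := GRing.Lmodule.on split_freeprod.
HB.instance Definition _ := GRing.PzRing.on split_freeprod.

Fact split_freeprod_oner_neq0 : 1 != 0 :> split_freeprod.
Proof.
apply/eqP => /(congr1 (freeprod_lift (@split_eval n) (@split_eval m))).
by rewrite rmorph1 raddf0; apply/eqP/oner_neq0.
Qed.
HB.instance Definition _ := GRing.PzSemiRing_isNonZero.Build split_freeprod
  split_freeprod_oner_neq0.
HB.instance Definition _ := GRing.LSemiModule_isLSemiAlgebra.Build R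
  split_freeprod (@freeprod_scaleAl R (split_alg R n) (split_alg R m)).
HB.instance Definition _ := GRing.Lalgebra_isAlgebra.Build R
  split_freeprod (@freeprod_scaleAr R (split_alg R n) (split_alg R m)).

Definition inS (s : split_alg R n) : split_freeprod := in_left (split_alg R m) s.
Definition inT (t : split_alg R m) : split_freeprod := in_right (split_alg R n) t.

Record extends_brackets
    (brS : split_alg R n -> split_alg R n -> split_alg R n \otimes split_alg R n)
    (brT : split_alg R m -> split_alg R m -> split_alg R m \otimes split_alg R m)
    (br : split_freeprod -> split_freeprod -> split_freeprod \otimes split_freeprod)
    : Prop := ExtendsBrackets {
  extends_poisson : double_poisson_bracket br;
  extends_left : forall s s',
    br (inS s) (inS s') = tlift (fun x y => inS x \ot inS y) (brS s s');
  extends_right : forall t t',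
    br (inT t) (inT t') = tlift (fun x y => inT x \ot inT y) (brT t t');
  extends_mixed : forall s t, br (inS s) (inT t) = 0 }.

End SplitFreeProduct.
Arguments inS {R n m}.
Arguments inT {R n m}.

(* The variety of N-dimensional representations over an algebraically closed
   field, through its closed points and their matrix coordinate functions. *)
Section Representations.
Variables (C : closedFieldType) (A : algType C) (N : nat).

(* 'M_N is a ring and a module for every N, but the library makes it an
   algebra only for N > 0, hence the explicit scalability. *)
Record representation := Representation {
  rep_morphism :> {rmorphism A -> 'M[C]_N};
  rep_scalable : scalable rep_morphism }.

Inductive regular : (representation -> C^o) -> Prop :=
| regular_coord a i j : regular (fun rho => rho a i j)
| regular_const z : regular (cst z)
| regular_add f g : regular f -> regular g -> regular (f + g)
| regular_mul f g : regular f -> regular g -> regular (f * g).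

Definition regular_pred : {pred (representation -> C^o)} :=
  [pred f | `[< regular f >]].

Lemma regular_predP f : reflect (regular f) (f \in regular_pred).
Proof. exact: asboolP. Qed.

Lemma regular_scale z f : regular f -> regular (z *: f).
Proof. by move=> rf; apply: regular_mul rf; apply: regular_const. Qed.

Fact regular_subring : subring_closed regular_pred.
Proof.
split=> [|f g /regular_predP rf /regular_predP rg|f g /regular_predP rf /regular_predP rg];
  apply/regular_predP.
- exact: regular_const.
- by apply: regular_add => //; rewrite -scaleN1r; apply: regular_scale.
- exact: regular_mul.
Qed.
Fact regular_submod : submod_closed regular_pred.
Proof.
split=> [|z f g /regular_predP rf /regular_predP rg]; apply/regular_predP.
- exact: regular_const.
- by apply: regular_add => //; apply: regular_scale.
Qed.
HB.instance Definition _ := GRing.isSubringClosed.Build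
  (representation -> C^o) regular_pred regular_subring.
HB.instance Definition _ := GRing.isSubmodClosed.Build C
  (representation -> C^o) regular_pred regular_submod.

Record coord_ring := CoordRing {
  coord_fun :> representation -> C^o;
  coord_regular : coord_fun \in regular_pred }.
HB.instance Definition _ := [isSub for coord_fun].
HB.instance Definition _ := [Choice of coord_ring by <:].
HB.instance Definition _ := GRing.SubChoice_isSubComPzRing.Build
  _ _ coord_ring (subringClosedP _).

HB.instance Definition _ := [SubZmodule_isSubLmodule of coord_ring by <:].

Definition coordf (a : A) (i j : 'I_N) : coord_ring :=
  CoordRing (introT (regular_predP _) (regular_coord a i j)).

Record poisson_bracket (br : coord_ring -> coord_ring -> coord_ring) : Prop :=
  PoissonBracket {
    poisson_bilinear : bilinear br;
    poisson_skew : forall f g, br f g = - br g f;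
    poisson_leibniz : forall f g h, br f (g * h) = br f g * h + g * br f h;
    poisson_jacobi : forall f g h,
      br f (br g h) + br g (br h f) + br h (br f g) = 0 }.

Record induced_bracket (dbr : A -> A -> A \otimes A)
    (br : coord_ring -> coord_ring -> coord_ring) : Prop := InducedBracket {
  induced_poisson : poisson_bracket br;
  induced_coord : forall a b i j k l,
    br (coordf a i j) (coordf b k l) =
      tlift (fun u v => coordf u k j * coordf v i l) (dbr a b) }.

(* The GL_N-invariants, that is the regular functions constant on isomorphism
   classes of representations. *)
Definition isomorphic (rho rho' : representation) : Prop :=
  exists2 g : 'M[C]_N, g \in unitmx & forall a, rho' a = g *m rho a *m invmx g.

Definition invariant_pred : {pred coord_ring} :=
  [pred f : coord_ring |
     `[< forall rho rho', isomorphic rho rho' -> f rho = f rho' >]].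

Lemma invariant_predP (f : coord_ring) :
  reflect (forall rho rho', isomorphic rho rho' -> f rho = f rho')
          (f \in invariant_pred).
Proof. exact: asboolP. Qed.

Fact invariant_subring : subring_closed invariant_pred.
Proof.
split=> [|f g /invariant_predP hf /invariant_predP hg|f g /invariant_predP hf /invariant_predP hg];
  apply/invariant_predP => rho rho' rr' //=.
- by congr (_ - _); [apply: hf | apply: hg].
- by congr (_ * _); [apply: hf | apply: hg].
Qed.
Fact invariant_submod : submod_closed invariant_pred.
Proof.
split=> [|z f g /invariant_predP hf /invariant_predP hg];
  apply/invariant_predP => rho rho' rr' //=.
by congr (_ *: _ + _); [apply: hf | apply: hg].
Qed.
HB.instance Definition _ := GRing.isSubringClosed.Build
  coord_ring invariant_pred invariant_subring.
HB.instance Definition _ := GRing.isSubmodClosed.Build C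
  coord_ring invariant_pred invariant_submod.

(* The coordinate ring of the quotient variety of semisimple representations. *)
Record invariant_ring := InvariantRing {
  invariant_fun :> coord_ring;
  invariant_invariant : invariant_fun \in invariant_pred }.
HB.instance Definition _ := [isSub for invariant_fun].
HB.instance Definition _ := [Choice of invariant_ring by <:].
HB.instance Definition _ := GRing.SubChoice_isSubComPzRing.Build
  _ _ invariant_ring (subringClosedP _).
HB.instance Definition _ := [SubZmodule_isSubLmodule of invariant_ring by <:].

Definition quotient_bracket (dbr : A -> A -> A \otimes A)
    (br : invariant_ring -> invariant_ring -> invariant_ring) : Prop :=
  exists2 brN : coord_ring -> coord_ring -> coord_ring,
    induced_bracket dbr brN &
    forall f g : invariant_ring, br f g = brN f g :> coord_ring.

Lemma trace_coordE a (rho : representation) :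
  (\sum_i coordf a i i : coord_ring) rho = \tr (rho a).
Proof.
rewrite -[coord_fun _]/(val _) raddf_sum fct_sumE.
by apply: eq_bigr.
Qed.

Fact trace_invariant a : \sum_i coordf a i i \in invariant_pred.
Proof.
apply/invariant_predP => rho rho' [g gU rr'].
by rewrite !trace_coordE rr' mxtrace_mulC mulmxA mulVmx // mul1mx.
Qed.

Definition tr (a : A) : invariant_ring := InvariantRing (trace_invariant a).

End Representations.
Arguments tr {C A N}.

(* Words are sequences of letters: sigma is defined on words and not on the
   elements of the algebra that they represent. *)
Section Words.
Variable A : pzRingType.

Definition word_value (w : seq A) : A := \prod_(a <- w) a.

Definition sigma (w : seq A) : seq A := rot 1 w.

Definition alternating (p : nat) (u v : 'I_p -> A) : seq A :=
  flatten [seq [:: u l; v l] | l <- enum 'I_p].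

Definition replace (p : nat) (u : 'I_p -> A) (k : 'I_p) (a : A) : 'I_p -> A :=
  fun l => if l == k then a else u l.

End Words.

(* Main.v *)
From HB Require Import structures.
Require Import Defs.
From mathcomp Require Import all_boot all_order all_algebra.
From mathcomp Require Import boolp functions.

(** The trace bracket is a cyclic-word expansion.  If T is a linear map with
    T (ab) = T (ba), applying u \ot v |-> T (u v) to the double bracket of a and
    b gives the bracket of the traces, because the induced bracket of matrix
    coordinates contracts its four indices exactly as the trace of a product
    does ([quotient_bracket_tr]).

    Both Leibniz rules of the double bracket, outer and inner, become the same
    cyclic Leibniz rule once T is applied: the letters around the one being
    differentiated are moved, in cyclic order, into a single cofactor.  Hence
    the trace of {{x, y}} is the sum, over a letter x_r of x and a letter y_s of
    y, of T (u X v Y), where u \ot v stands for {{x_r, y_s}} and X, Y are the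
    words obtained by reading x and y cyclically from just after that letter
    ([pairing_words]).

    Mixed pairs of letters contribute zero.  For two idempotents of the same
    factor the double bracket is a multiple of e_a \ot e_b - e_b \ot e_a if
    a <> b, and is e_a \ot bar e_a - bar e_a \ot e_a if a = b, the sum over
    s <> a in the diagonal bracket being absorbed into bar e_a.  Putting u in
    front of X and v in front of Y restores two rotated words; in the opposite
    term, cyclicity of T puts the letters at the ends of X and Y, which gives
    the next rotations ([pairing_idem]).

    What remains is bookkeeping: the even positions of an alternating word hold
    the letters e, the odd ones the letters f, and one of the sums is reindexed
    by the cyclic successor, since rotating a word by its length changes
    nothing. *)

Set Implicit Arguments.
Unset Strict Implicit.
Unset Printing Implicit Defensive.

Import GRing.Theory.
Local Open Scope ring_scope.

Local Notation bilinear f := (bilinear_for *:%R *:%R f).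

(** * Cyclic words *)

Section CyclicWords.
Variable A : pzRingType.
Implicit Types w : seq A.

(** The linear word into which the cyclic word w is cut by removing its letter at
    position r. *)
Definition cyclic_cofactor (r : nat) w : A :=
  word_value (drop r.+1 w) * word_value (take r w).

Lemma word_value_cat w1 w2 :
  word_value (w1 ++ w2) = word_value w1 * word_value w2.
Proof. exact: big_cat. Qed.

Lemma word_value_cons a w : word_value (a :: w) = a * word_value w.
Proof. exact: big_cons. Qed.

Lemma iter_sigma r w : (r <= size w)%N -> iter r (@sigma A) w = rot r w.
Proof.
elim: r => [|r IH] rw; first by rewrite rot0.
by rewrite iterS IH ?(ltnW rw) // rotS.
Qed.

Lemma rotation_before r w : (r < size w)%N ->
  word_value (iter r (@sigma A) w) = w`_r * cyclic_cofactor r w.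
Proof.
move=> rw; rewrite iter_sigma ?(ltnW rw) // /rot (drop_nth 0) //.
by rewrite word_value_cat word_value_cons mulrA.
Qed.

Lemma rotation_after r w : (r < size w)%N ->
  word_value (iter r.+1 (@sigma A) w) = cyclic_cofactor r w * w`_r.
Proof.
move=> rw; rewrite iter_sigma // /rot (take_nth 0) // -cats1.
by rewrite !word_value_cat word_value_cons /word_value big_nil mulr1 mulrA.
Qed.

Lemma cyclic_cofactor_set_nth r w a : (r < size w)%N ->
  cyclic_cofactor r (set_nth 0 w r a) = cyclic_cofactor r w.
Proof.
move=> rw; rewrite /cyclic_cofactor set_nthE rw -cat_rcons.
have sr : size (rcons (take r w) a) = r.+1.
  by rewrite size_rcons size_takel ?(ltnW rw).
rewrite drop_cat take_cat sr ltnn subnn drop0 ltnSn.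
by rewrite -cats1 takel_cat ?size_takel ?(ltnW rw) // take_takel.
Qed.

(** The second argument of D accumulates the letters already passed.  The rule
    assumed for D is what a derivation becomes under a trace, where the factors
    on both sides of the differentiated one merge into a single cofactor. *)
Lemma cyclic_leibniz (U : zmodType) (D : A -> A -> U) :
  (forall y z b, D (y * z) b = D y (z * b) + D z (b * y)) ->
  forall w, D (word_value w) 1 = \sum_(r < size w) D w`_r (cyclic_cofactor r w).
Proof.
move=> DM w.
(* generalized over the accumulated cofactor b for the induction *)
suff H b : D (word_value w) b =
    \sum_(r < size w) D w`_r (word_value (drop r.+1 w) * b * word_value (take r w)).
  by rewrite H; apply: eq_bigr => r _; rewrite mulr1.
elim: w b => [|a w IH] b.
  rewrite /word_value big_nil big_ord0.
  (* D 1 b = D 1 b + D 1 b, as for any derivation *)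
  have := DM 1 1 b; rewrite !mul1r mulr1 => /(congr1 (+%R^~ (- D 1 b))).
  by rewrite subrr addrK.
rewrite word_value_cons DM IH big_ord_recl /= drop0.
rewrite [word_value [::]]/word_value big_nil mulr1.
congr (_ + _); apply: eq_bigr => r _.
by rewrite word_value_cons !mulrA.
Qed.

(** For the last index the left side rotates w by its full length, while ordS
    wraps around to 0. *)
Lemma iter_sigma_ordS h (l : 'I_h) w : size w = (h * 2)%N ->
  iter (2 * l + 2) (@sigma A) w = iter (2 * ordS l) (@sigma A) w.
Proof.
move=> sw; rewrite -[X in (_ + X)%N]muln1 -mulnDr addn1.
have -> : ordS l = (l.+1 %% h)%N :> nat by [].
have [lh|] := ltnP l.+1 h; first by rewrite modn_small.
move=> hl; have -> : l.+1 = h by apply/eqP; rewrite eqn_leq hl ltn_ord.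
by rewrite modnn (mulnC 2%N h) -sw iter_sigma // rot_size.
Qed.

Section Alternating.
Variables (p : nat) (u v : 'I_p -> A).

Lemma size_alternating : size (alternating u v) = (p * 2)%N.
Proof.
rewrite size_flatten sumnE 2!big_map /= big_const_seq count_predT.
by rewrite size_enum_ord iter_addn_0 mulnC.
Qed.

Lemma odd_lt_alternating (l : 'I_p) : (2 * l + 1 < size (alternating u v))%N.
Proof.
by rewrite size_alternating addn1 mulnC -[_.+2]/(2 + l * 2)%N -mulSn leq_mul2r ltn_ord.
Qed.

Lemma even_lt_alternating (l : 'I_p) : (2 * l < size (alternating u v))%N.
Proof. by apply: leq_ltn_trans (odd_lt_alternating l); rewrite addn1. Qed.

Lemma nth_alternating_even (l : 'I_p) : (alternating u v)`_(2 * l) = u l.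
Proof.
have <- : nth (u l) [seq u i | i <- enum 'I_p] l = u l.
  by rewrite (nth_map l) ?size_enum_ord // nth_ord_enum.
have: (l < size (enum 'I_p))%N by rewrite size_enum_ord.
rewrite /alternating mulnC; elim: (enum 'I_p) (l : nat) => [//|i s IH] [|r] //=.
exact: IH.
Qed.

Lemma nth_alternating_odd (l : 'I_p) : (alternating u v)`_(2 * l + 1) = v l.
Proof.
have <- : nth (v l) [seq v i | i <- enum 'I_p] l = v l.
  by rewrite (nth_map l) ?size_enum_ord // nth_ord_enum.
have: (l < size (enum 'I_p))%N by rewrite size_enum_ord.
rewrite /alternating mulnC addn1.
elim: (enum 'I_p) (l : nat) => [//|i s IH] [|r] //=.
exact: IH.
Qed.

End Alternating.

Lemma alternating_ext p (u v : 'I_p -> A) w : size w = (p * 2)%N ->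
  (forall l : 'I_p, w`_(2 * l) = u l) -> (forall l : 'I_p, w`_(2 * l + 1) = v l) ->
  w = alternating u v.
Proof.
move=> sw we wo; apply: (@eq_from_nth _ 0); first by rewrite size_alternating.
move=> r; rewrite sw => rp.
have lp : (r./2 < p)%N.
  rewrite -(@ltn_pmul2r 2) // muln2; apply: leq_ltn_trans rp.
  by rewrite -{2}(odd_double_half r) leq_addl.
rewrite -(odd_double_half r) -mul2n addnC; case: (odd r).
  by rewrite (wo (Ordinal lp)) (nth_alternating_odd _ _ (Ordinal lp)).
by rewrite addn0 (we (Ordinal lp)) (nth_alternating_even _ _ (Ordinal lp)).
Qed.

(** Meant for [cyclic_cofactor_set_nth]: in this form, a replaced letter is seen
    to leave the cofactor of its own position unchanged. *)
Lemma replace_even p (u v : 'I_p -> A) (k : 'I_p) a :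
  alternating (replace u k a) v = set_nth 0 (alternating u v) (2 * k) a.
Proof.
symmetry; apply: alternating_ext => [|l|l].
- by rewrite size_set_nth (maxn_idPr (even_lt_alternating u v k)) size_alternating.
- by rewrite nth_set_nth /= eqn_pmul2l // nth_alternating_even.
- rewrite nth_set_nth /= nth_alternating_odd.
  by case: eqP => // /(congr1 odd); rewrite oddD !oddM.
Qed.

Lemma replace_odd p (u v : 'I_p -> A) (k : 'I_p) a :
  alternating u (replace v k a) = set_nth 0 (alternating u v) (2 * k + 1) a.
Proof.
symmetry; apply: alternating_ext => [|l|l].
- by rewrite size_set_nth (maxn_idPr (odd_lt_alternating u v k)) size_alternating.
- rewrite nth_set_nth /= nth_alternating_even.
  by case: eqP => // /(congr1 odd); rewrite oddD !oddM.
- by rewrite nth_set_nth /= eqn_add2r eqn_pmul2l // nth_alternating_odd.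
Qed.

Lemma sum_alternating (U : nmodType) p (F : nat -> U) :
  \sum_(r < p * 2) F r = \sum_(l < p) (F (2 * l)%N + F (2 * l + 1)%N).
Proof.
rewrite -(big_mkord xpredT F) big_nat_mul big_mkord; apply: eq_bigr => l _.
rewrite mulSn (mulnC l) addn1 -[(2 + _)%N]/((2 * l).+2).
by rewrite big_ltn ?leqnSn // big_ltn // big_geq //= addr0.
Qed.

End CyclicWords.

(** * Double brackets under a trace *)

(** [tlift_unique] for functions that carry no canonical linear structure. *)
Lemma tensor_linear_ext (R : comNzRingType) (V W X : lmodType R)
    (f g : V \otimes W -> X) :
  linear f -> linear g -> (forall v w, f (v \ot w) = g (v \ot w)) ->
  forall t, f t = g t.
Proof.
move=> lf lg fg t.
pose lf' := GRing.isLinear.Build R (V \otimes W) X *:%R f lf.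
pose lg' := GRing.isLinear.Build R (V \otimes W) X *:%R g lg.
pose f' : {linear V \otimes W -> X} := HB.pack f lf'.
pose g' : {linear V \otimes W -> X} := HB.pack g lg'.
exact: (@tlift_unique R V W X f' g' fg t).
Qed.

Lemma tlift_map (R : comNzRingType) (V W V' W' X : lmodType R)
    (f : V -> V') (g : W -> W') (h : V' -> W' -> X) t :
  linear f -> linear g -> bilinear h ->
  tlift h (tlift (fun v w => f v \ot g w) t) = tlift (fun v w => h (f v) (g w)) t.
Proof.
move=> lf lg bh.
have bt : bilinear (fun v w => f v \ot g w).
  have [tl tr'] := tens_bilinear V' W'.
  by split=> [w a v v'|v a w w'] /=; rewrite ?lf ?lg ?tl ?tr'.
have bhfg : bilinear (fun v w => h (f v) (g w)).
  by case: bh => hl hr; split=> [w a v v'|v a w w'] /=; rewrite ?lf ?lg ?hl ?hr.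
apply: (tensor_linear_ext (f := tlift h \o tlift (fun v w => f v \ot g w))).
- by move=> a u u' /=; rewrite (tlift_linear bt) (tlift_linear bh).
- exact: tlift_linear.
- by move=> v w /=; rewrite !tlift_tens.
Qed.

Section TracePairing.
Variables (R : comNzRingType) (A : algType R) (U : lmodType R).
Variable T : {linear A -> U}.

(** The trace of a double bracket inserted into a pair of cyclic words: a and b
    are the cofactors of the two letters whose double bracket is t. *)
Definition pairing (a b : A) (t : A \otimes A) : U :=
  tlift (fun u v => T (u * a * v * b)) t.

Lemma pairing_bilinear a b : bilinear (fun u v => T (u * a * v * b)).
Proof.
split=> [v r u u'|u r v v'] /=.
- by rewrite !mulrDl -!scalerAl linearP.
- by rewrite mulrDr mulrDl -scalerAr -scalerAl linearP.
Qed.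

Lemma pairing_tens a b u v : pairing a b (u \ot v) = T (u * a * v * b).
Proof. exact/tlift_tens/pairing_bilinear. Qed.

Lemma pairing_is_linear a b : linear (pairing a b).
Proof. exact/tlift_linear/pairing_bilinear. Qed.
HB.instance Definition _ a b := GRing.isLinear.Build R (A \otimes A) U *:%R
  (pairing a b) (pairing_is_linear a b).

Hypothesis T_cyclic : forall a b, T (a * b) = T (b * a).

Lemma pairing_outer a b y z t :
  pairing a b (outer y t z) = pairing a (z * b * y) t.
Proof.
have l1 : linear (fun u : A => y * u).
  by move=> r u v; rewrite mulrDr -scalerAr.
have l2 : linear (fun u : A => u * z).
  by move=> r u v; rewrite mulrDl -scalerAl.
rewrite /pairing /outer (tlift_map _ l1 l2 (pairing_bilinear a b)).
apply: eq_bigr => -[u v] _ /=.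
by rewrite -!mulrA T_cyclic !mulrA.
Qed.

Lemma pairing_tswap a b t : pairing a b (tswap t) = pairing b a t.
Proof.
have bs : bilinear (fun u v : A => v \ot u).
  have [tl tr'] := tens_bilinear A A.
  by split=> [w a' v v'|v a' w w'] /=; rewrite ?tl ?tr'.
apply: (tensor_linear_ext (f := pairing a b \o @tswap R A)).
- by move=> r u u' /=; rewrite /tswap (tlift_linear bs) linearP.
- exact: linearP.
- move=> u v; rewrite /= /tswap tlift_tens // !pairing_tens.
  by rewrite -mulrA T_cyclic !mulrA.
Qed.

Variable br : A -> A -> A \otimes A.
Hypothesis br_double : double_bracket br.

Lemma pairing_derivation_right a b x y z :
  pairing a b (br x (y * z)) =
  pairing a (z * b) (br x y) + pairing a (b * y) (br x z).
Proof.
rewrite (double_bracket_derivation br_double) linearD /=.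
by rewrite !pairing_outer mulr1 mul1r.
Qed.

Lemma pairing_skew a b x y : pairing a b (br x y) = - pairing b a (br y x).
Proof. by rewrite (double_bracket_skew br_double) linearN /= pairing_tswap. Qed.

(** Skew-symmetry exchanges the two cofactors, so that it carries the rule for
    the second argument to the first one. *)
Lemma pairing_derivation_left a b x w y :
  pairing a b (br (x * w) y) =
  pairing (w * a) b (br x y) + pairing (a * x) b (br w y).
Proof.
rewrite pairing_skew pairing_derivation_right opprD.
by rewrite -!(pairing_skew _ _ _ y).
Qed.

Lemma pairing_words x y :
  pairing 1 1 (br (word_value x) (word_value y)) =
  \sum_(r < size x) \sum_(s < size y)
    pairing (cyclic_cofactor r x) (cyclic_cofactor s y) (br x`_r y`_s).
Proof.
have left_leibniz := cyclic_leibniz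
  (D := fun z a => pairing a 1 (br z (word_value y)))
  (fun u v a => pairing_derivation_left a 1 u v (word_value y)).
rewrite [LHS]left_leibniz; apply: eq_bigr => r _.
exact: (cyclic_leibniz
  (D := fun z b => pairing (cyclic_cofactor r x) b (br x`_r z))
  (fun u v b => pairing_derivation_right (cyclic_cofactor r x) b x`_r u v)).
Qed.

End TracePairing.

(** * The bracket of two traces *)

Section Traces.
Variables (C : closedFieldType) (A : algType C) (N : nat).

Lemma coord_ring_ext (f g : coord_ring A N) : (forall rho, f rho = g rho) -> f = g.
Proof. by move=> fg; apply/val_inj/funext. Qed.

Lemma coordfP z (a b : A) (i j : 'I_N) :
  coordf (z *: a + b) i j = z *: coordf a i j + coordf b i j.
Proof.
apply: coord_ring_ext => rho.
by rewrite /= rmorphD rep_scalable !mxE.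
Qed.

Lemma coordfM (a b : A) (i j : 'I_N) :
  coordf (a * b) i j = \sum_k coordf a i k * coordf b k j.
Proof.
apply: coord_ring_ext => rho.
rewrite -[RHS]/(val _ rho) raddf_sum fct_sumE /= rmorphM mxE.
by apply: eq_bigr.
Qed.

Lemma tr_linear : linear (@tr C A N).
Proof.
move=> z a b; apply: val_inj; rewrite /= scaler_sumr -big_split.
by apply: eq_bigr => i _; rewrite coordfP.
Qed.
HB.instance Definition _ := GRing.isLinear.Build C A (invariant_ring A N) *:%R
  (@tr C A N) tr_linear.

Lemma tr_cyclic (a b : A) : tr (a * b) = tr (b * a) :> invariant_ring A N.
Proof.
apply: val_inj => /=.
under eq_bigr do rewrite coordfM.
under [RHS]eq_bigr do rewrite coordfM.
rewrite exchange_big; apply: eq_bigr => i _; apply: eq_bigr => k _.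
exact: mulrC.
Qed.

(** With t = u \ot v the double bracket of a and b, summing the bracket of a_ii
    and b_kk over i and k gives the sum of u_ki v_ik, the trace of u v. *)
Lemma quotient_bracket_tr dbr br (a b : A) : quotient_bracket dbr br ->
  br (tr a) (tr b) = tlift (fun u v => tr (u * v)) (dbr a b) :> invariant_ring A N.
Proof.
case=> brN [[bil _ _ _] brN_coord] br_brN.
apply: val_inj; rewrite [LHS]br_brN /=.
rewrite (big_morph (brN^~ _) (fun f g => bilinearDl f g _ bil) (bilinear0l _ bil)).
(* [tlift] is a sum over a chosen representative of the tensor, the same one on
   both sides, so that the identity can be checked term by term *)
rewrite -[RHS]/(val (\sum_(t <- repr (dbr a b))
                        (tr (t.1 * t.2) : invariant_ring A N))).
rewrite raddf_sum /=.
under [RHS]eq_bigr => t _.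
  under eq_bigr => k _ do rewrite coordfM.
  rewrite exchange_big /=; over.
rewrite [RHS]exchange_big; apply: eq_bigr => i _.
rewrite (big_morph (brN _) (fun f g => bilinearDr _ f g bil) (bilinear0r _ bil)).
rewrite [RHS]exchange_big; apply: eq_bigr => k _.
exact: brN_coord.
Qed.

End Traces.

(** * Letters that are idempotents *)

(** The diagonal bracket is minus a sum over s of multiples of
    e_a \ot e_s - e_s \ot e_a, which bilinearity gathers into a single
    commutator with bar e_a. *)
Lemma quad_bracket_idemE (R : comNzRingType) n (c : 'I_n.+1 -> 'I_n.+1 -> R) a b :
  quad_bracket c (idem a) (idem b) =
    if b == a then idem a \ot idem_bar c b - idem_bar c b \ot idem a
    else skew_coef c a b *: (idem a \ot idem b - idem b \ot idem a).
Proof.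
have [->|nba] := eqVneq b a; last by rewrite quad_bracket_neq // eq_sym.
have bt := tens_bilinear (split_alg R n) (split_alg R n).
rewrite quad_bracket_diag /idem_bar.
rewrite -[- (\sum_(s | s != a) skew_coef c a s *: idem s)]scaleN1r.
rewrite (bilinearZl _ _ _ bt) (bilinearZr _ _ _ bt) -scalerBr scaleN1r.
congr (- _).
rewrite (big_morph (tens _) (fun f g => bilinearDr _ f g bt) (bilinear0r _ bt)).
rewrite (big_morph (tens^~ _) (fun f g => bilinearDl f g _ bt) (bilinear0l _ bt)).
rewrite -sumrB; apply: eq_bigr => s sa.
rewrite quad_bracket_neq 1?eq_sym // (bilinearZl _ _ _ bt).
by rewrite (bilinearZr _ _ _ bt) scalerBr.
Qed.

Section SplitLetters.
Variables (R : comNzRingType) (A : algType R) (U : lmodType R).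
Variable T : {linear A -> U}.
Hypothesis T_cyclic : forall a b, T (a * b) = T (b * a).
Variables (k : nat) (c : 'I_k.+1 -> 'I_k.+1 -> R) (g : split_alg R k -> A).
Hypothesis g_linear : linear g.
Variable br : A -> A -> A \otimes A.
Hypothesis br_g : forall s s',
  br (g s) (g s') = tlift (fun x y => g x \ot g y) (quad_bracket c s s').

Local Notation turn r w := (word_value (iter r (@sigma A) w)).

(** With X and Y the cofactors, T (g_a X g_b Y) multiplies the words rotated so
    as to start at the chosen letters, and T (g_b X g_a Y) = T (X g_a Y g_b) the
    words rotated so as to end there.  If a = b one of the two letters is
    bar e_b; it is charged to y, whose cofactor does not see the change. *)
Lemma pairing_idem (x y : seq A) (r s : nat) (a b : 'I_k.+1) :
  (r < size x)%N -> (s < size y)%N -> x`_r = g (idem a) -> y`_s = g (idem b) ->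
  pairing T (cyclic_cofactor r x) (cyclic_cofactor s y) (br x`_r y`_s) =
    let y' := set_nth 0 y s (g (idem_bar c b)) in
    if b == a then T (turn r x * turn s y') - T (turn r.+1 x * turn s.+1 y')
    else skew_coef c a b *:
      (T (turn r x * turn s y) - T (turn r.+1 x * turn s.+1 y)).
Proof.
move=> rx sy xr ys /=.
have sy' (u : A) : (s < size (set_nth 0%R y s u))%N.
  by rewrite size_set_nth leq_max leqnn.
rewrite !rotation_before // !rotation_after // cyclic_cofactor_set_nth //.
rewrite nth_set_nth /= eqxx.
set X := cyclic_cofactor r x; set Y := cyclic_cofactor s y.
have bg : bilinear (fun u v : split_alg R k => g u \ot g v).
  have [tl tr'] := tens_bilinear A A.
  by split=> [w z v v'|v z w w'] /=; rewrite !g_linear ?tl ?tr'.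
have E (u v : split_alg R k) :
    pairing T X Y (tlift (fun u v : split_alg R k => g u \ot g v)
                         (u \ot v - v \ot u)) =
    T (g u * X * (g v * Y)) - T (X * g u * (Y * g v)).
  rewrite -[- _]scaleN1r addrC (tlift_linear bg) !tlift_tens // scaleN1r addrC.
  rewrite linearB /= !pairing_tens !mulrA; congr (_ - _).
  by rewrite -!mulrA T_cyclic !mulrA.
rewrite xr ys br_g quad_bracket_idemE; case: (b == a); first exact: E.
rewrite -[_ *: _]addr0 (tlift_linear bg) [tlift _ 0]tlift0 // addr0 linearZ /=.
by rewrite E.
Qed.

End SplitLetters.

(** * The bracket of two alternating words *)

Theorem proposition7
  (C : closedFieldType) (C_char0 : [pchar C] =i pred0)
  (n m : nat)
  (c : 'I_n.+1 -> 'I_n.+1 -> C) (d : 'I_m.+1 -> 'I_m.+1 -> C)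
  (c_poisson : double_poisson_bracket (quad_bracket c))
  (d_poisson : double_poisson_bracket (quad_bracket d))
  (dbr : split_freeprod C n m -> split_freeprod C n m ->
         split_freeprod C n m \otimes split_freeprod C n m)
  (dbr_extends : extends_brackets (quad_bracket c) (quad_bracket d) dbr)
  (N : nat)
  (br : invariant_ring (split_freeprod C n m) N ->
        invariant_ring (split_freeprod C n m) N ->
        invariant_ring (split_freeprod C n m) N)
  (br_induced : quotient_bracket dbr br)
  (p q : nat) (p_gt0 : (0 < p)%N) (q_gt0 : (0 < q)%N)
  (i : 'I_p -> 'I_n.+1) (i' : 'I_p -> 'I_m.+1)
  (j : 'I_q -> 'I_n.+1) (j' : 'I_q -> 'I_m.+1) :
  let e (a : 'I_n.+1) : split_freeprod C n m := inS (idem a) in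
  let f (b : 'I_m.+1) : split_freeprod C n m := inT (idem b) in
  let ebar (a : 'I_n.+1) : split_freeprod C n m := inS (idem_bar c a) in
  let fbar (b : 'I_m.+1) : split_freeprod C n m := inT (idem_bar d b) in
  let cbar := skew_coef c in
  let dbar := skew_coef d in
  let x := alternating (e \o i) (f \o i') in
  let y := alternating (e \o j) (f \o j') in
  let y_f (k : 'I_q) :=
    alternating (e \o j) (replace (f \o j') k (fbar (j' k))) in
  let y_e (k : 'I_q) :=
    alternating (replace (e \o j) k (ebar (j k))) (f \o j') in
  (* with l and k counted from 0, the exponents 2l-2, 2l-1, 2l of sigma for l
     counted from 1 become 2l, 2l+1, 2l+2; and ordS is the cyclic successor *)
  let sg (r : nat) (w : seq (split_freeprod C n m)) :=
    word_value (iter r (@sigma _) w) in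
  br (tr (word_value x)) (tr (word_value y)) =
  \sum_(l < p) (
    tr (sg (2 * l + 1)%N x *
        (\sum_(k | j' k != i' l) dbar (i' l) (j' k) *: sg (2 * k + 1)%N y
         - \sum_(k | j k != i l) cbar (i l) (j k) *: sg (2 * k + 1)%N y))
    - tr (sg (2 * l + 2)%N x *
        (\sum_(k | j' k != i' l) dbar (i' l) (j' k) *: sg (2 * k + 2)%N y
         - \sum_(k | j (ordS k) != i (ordS l))
             cbar (i (ordS l)) (j (ordS k)) *: sg (2 * k + 2)%N y))
    + \sum_(k | j' k == i' l)
        (tr (sg (2 * l + 1)%N x * sg (2 * k + 1)%N (y_f k))
         - tr (sg (2 * l + 2)%N x * sg (2 * k + 2)%N (y_f k)))
    + \sum_(k | j k == i l)
        (tr (sg (2 * l)%N x * sg (2 * k)%N (y_e k))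
         - tr (sg (2 * l + 1)%N x * sg (2 * k + 1)%N (y_e k)))).
Proof.
move=> e f ebar fbar cbar dbar x y y_f y_e sg.
have dbl : double_bracket dbr := extends_poisson dbr_extends.
have TC := @tr_cyclic C (split_freeprod C n m) N.
have inS_linear : linear (@inS C n m) := @in_left_linear _ _ _.
have inT_linear : linear (@inT C n m) := @in_right_linear _ _ _.
pose TR :
  {linear split_freeprod C n m -> invariant_ring (split_freeprod C n m) N} :=
  @tr _ _ N.
have xe (l : 'I_p) : x`_(2 * l) = e (i l) by apply: nth_alternating_even.
have xf (l : 'I_p) : x`_(2 * l + 1) = f (i' l) by apply: nth_alternating_odd.
have ye (k : 'I_q) : y`_(2 * k) = e (j k) by apply: nth_alternating_even.
have yf (k : 'I_q) : y`_(2 * k + 1) = f (j' k) by apply: nth_alternating_odd.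
pose t r s :
    invariant_ring (split_freeprod C n m) N := tr (sg r x * sg s y).
pose B r s :=
  pairing TR (cyclic_cofactor r x) (cyclic_cofactor s y) (dbr x`_r y`_s).
pose te (l : 'I_p) (k : 'I_q) :
    invariant_ring (split_freeprod C n m) N :=
  tr (sg (2 * l)%N x * sg (2 * k)%N (y_e k))
  - tr (sg (2 * l + 1)%N x * sg (2 * k + 1)%N (y_e k)).
pose tf (l : 'I_p) (k : 'I_q) :
    invariant_ring (split_freeprod C n m) N :=
  tr (sg (2 * l + 1)%N x * sg (2 * k + 1)%N (y_f k))
  - tr (sg (2 * l + 2)%N x * sg (2 * k + 2)%N (y_f k)).
have Bee (l : 'I_p) (k : 'I_q) : B (2 * l)%N (2 * k)%N =
    if j k == i l then te l k
    else cbar (i l) (j k) *: (t (2 * l)%N (2 * k)%N - t (2 * l + 1)%N (2 * k + 1)%N).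
  rewrite /te /y_e replace_even /t !addn1.
  exact: (pairing_idem (T := TR) TC inS_linear (extends_left dbr_extends)
    (even_lt_alternating _ _ l) (even_lt_alternating _ _ k) (xe l) (ye k)).
(* the rotation exponents are put in the form in which they follow the odd
   position 2l+1 *)
have add2E r : (r + 2 = (r + 1).+1)%N by rewrite addn2 addn1.
have Bff (l : 'I_p) (k : 'I_q) : B (2 * l + 1)%N (2 * k + 1)%N =
    if j' k == i' l then tf l k
    else dbar (i' l) (j' k) *:
      (t (2 * l + 1)%N (2 * k + 1)%N - t (2 * l + 2)%N (2 * k + 2)%N).
  rewrite /tf /y_f replace_odd /t !add2E.
  exact: (pairing_idem (T := TR) TC inT_linear (extends_right dbr_extends)
    (odd_lt_alternating _ _ l) (odd_lt_alternating _ _ k) (xf l) (yf k)).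
have Bef (l : 'I_p) (k : 'I_q) : B (2 * l)%N (2 * k + 1)%N = 0.
  by rewrite /B xe yf (extends_mixed dbr_extends) raddf0.
have Bfe (l : 'I_p) (k : 'I_q) : B (2 * l + 1)%N (2 * k)%N = 0.
  rewrite /B xf ye (pairing_skew TC dbl) (extends_mixed dbr_extends).
  by rewrite raddf0 oppr0.
have wrap (w : seq (split_freeprod C n m)) h (l : 'I_h) : size w = (h * 2)%N ->
    sg (2 * l + 2)%N w = sg (2 * ordS l)%N w.
  by move=> sw; rewrite /sg (iter_sigma_ordS _ sw).
pose G (l : 'I_p) (k : 'I_q) := cbar (i l) (j k) *: t (2 * l)%N (2 * k)%N.
have shift : \sum_(l < p) \sum_(k < q | j (ordS k) != i (ordS l))
      cbar (i (ordS l)) (j (ordS k)) *: t (2 * l + 2)%N (2 * k + 2)%N =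
    \sum_(l < p) \sum_(k < q | j k != i l) G l k.
  rewrite [RHS](reindex_inj (@ordS_inj p)); apply: eq_bigr => l _.
  rewrite [RHS](reindex_inj (@ordS_inj q)); apply: eq_bigr => k _.
  by rewrite /G /t !wrap // size_alternating.
have -> : br (tr (word_value x)) (tr (word_value y)) =
    \sum_(l < p) \sum_(k < q) (B (2 * l)%N (2 * k)%N + B (2 * l + 1)%N (2 * k + 1)%N).
  rewrite (quotient_bracket_tr _ _ br_induced).
  transitivity (pairing TR 1 1 (dbr (word_value x) (word_value y))).
    by apply: eq_bigr => u _; rewrite !mulr1.
  rewrite (pairing_words TC dbl) !size_alternating.
  rewrite (sum_alternating p (fun r => \sum_(s < q * 2) B r s)).
  apply: eq_bigr => l _; rewrite !sum_alternating -big_split.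
  by apply: eq_bigr => k _; rewrite Bef Bfe addr0 add0r.
have tr_sum u (P : pred 'I_q) (a : 'I_q -> C) z :
    tr (u * \sum_(k | P k) a k *: z k) = \sum_(k | P k) a k *: TR (u * z k).
  rewrite mulr_sumr linear_sum; apply: eq_bigr => k _ /=.
  by rewrite -scalerAr linearZ.
under [RHS]eq_bigr => l _ do rewrite !mulrBr !linearB /= !tr_sum.
rewrite 3!big_split /= !sumrB !sumrN opprK shift.
under eq_bigr => l _.
  rewrite big_split /= (bigID (fun k => j k == i l)) /=.
  rewrite [X in _ + X](bigID (fun k => j' k == i' l)) /=.
  rewrite (eq_bigr (te l)) => [|k jk]; last by rewrite Bee jk.
  rewrite [X in (_ + X) + _](eq_bigr (fun k => G l k -
      cbar (i l) (j k) *: t (2 * l + 1)%N (2 * k + 1)%N)) => [|k jk]; last first.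
    by rewrite Bee (negbTE jk) scalerBr.
  rewrite [X in _ + (X + _)](eq_bigr (tf l)) => [|k jk]; last by rewrite Bff jk.
  rewrite [X in _ + (_ + X)](eq_bigr (fun k =>
      dbar (i' l) (j' k) *: t (2 * l + 1)%N (2 * k + 1)%N
      - dbar (i' l) (j' k) *: t (2 * l + 2)%N (2 * k + 2)%N)) => [|k jk]; last first.
    by rewrite Bff (negbTE jk) scalerBr.
  rewrite [X in (_ + X) + _]sumrB [X in _ + (_ + X)]sumrB; over.
rewrite !big_split /= !sumrN !addrA.
by rewrite [LHS](ACl (5 * 3 * 6 * 2 * 4 * 1)).
Qed.
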